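(* Let $c$ and $l\geq 3$ be positive integers and let $\mathbf{c}$ be a $c$-coloring of $\mathbb{N}$ (i.e. a map $\mathbf{c}\colon\mathbb{N}\to[c]=\{1,\dots,c\}$). Then there are $l$-term arithmetic progressions $Q_1,Q_2,Q_3,\dots$ of positive integers such that (i) $Q_1\prec Q_2\prec Q_3\prec\cdots$, and (ii) there is $\gamma\in[c]$ such that for every finite nonempty set $C\subseteq\mathbb{N}$ and every $s\in\{1,\dots,l\}$ we have \[ \mathbf{c}\Big(\bigoplus_{i\in C}Q_i\,[s]\Big)=\mathbf{c}\Big(\Delta\big(\bigoplus_{i\in C}Q_i\big)\Big)=\gamma, \] where $\Delta(P)$ denotes the common difference of an arithmetic progression $P$.
   Context: $\mathbb{N}$ denotes the positive integers. An $l$-term arithmetic progression $P=\{a_1,\dots,a_l\}$ is written with $a_1<\dots<a_l$ (so the common difference $\Delta(P)=a_2-a_1$ is positive), and $P[s]=a_s$ denotes its $s$-th term. For $l$-term arithmetic progressions $P,Q$, the pointwise sum $P\oplus Q$ is the $l$-term arithmetic progression with $(P\oplus Q)[s]=P[s]+Q[s]$ for $1\le s\le l$; for a finite nonempty index set $C$, $\bigoplus_{i\in C}Q_i$ is the pointwise sum of the $Q_i$, $i\in C$, so $\bigoplus_{i\in C}Q_i\,[s]=\sum_{i\in C}Q_i[s]$. We write $P\prec Q$ if $P[s]<Q[s]$ for all $1\le s\le l$. *)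

(* Defs.v *)
From mathcomp Require Import all_boot.
From mathcomp Require Import finmap.

Set Implicit Arguments.
Unset Strict Implicit.
Unset Printing Implicit Defensive.

(* The paper's term P[s] (1 <= s <= l) is [tnth P (s - 1)]: ordinals of ['I_l] *)
(* start at 0.                                                               *)

Definition is_ap (l : nat) (P : l.-tuple nat) : Prop :=
  exists a d : nat, 0 < d /\ forall s : 'I_l, tnth P s = a + s * d.

(* Only meaningful when l >= 2; natural-number subtraction is harmless because *)
(* the terms of an arithmetic progression are increasing.                    *)
Definition ap_diff (l : nat) (P : l.-tuple nat) : nat := nth 0 P 1 - nth 0 P 0.

Definition ap_prec (l : nat) (P Q : l.-tuple nat) : Prop :=
  forall s : 'I_l, tnth P s < tnth Q s.

Definition ap_sum (l : nat) (C : {fset nat}) (Q : nat -> l.-tuple nat) :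
    l.-tuple nat :=
  [tuple \sum_(i <- C) tnth (Q i) s | s < l].

Lemma ap_sumE (l : nat) (C : {fset nat}) (Q : nat -> l.-tuple nat) (s : 'I_l) :
  tnth (ap_sum C Q) s = \sum_(i <- C) tnth (Q i) s.
Proof. by rewrite tnth_mktuple. Qed.

Lemma ap_diffE (l : nat) (P : l.-tuple nat) (a d : nat) :
  1 < l -> (forall s : 'I_l, tnth P s = a + s * d) -> ap_diff P = d.
Proof.
move=> l1 HP; have l0 : 0 < l by apply: ltnW.
have := HP (Ordinal l1); have := HP (Ordinal l0).
rewrite !(tnth_nth 0) /ap_diff /= => -> ->.
by rewrite mul0n addn0 mul1n addKn.
Qed.

Lemma is_ap_sum (l : nat) (C : {fset nat}) (Q : nat -> l.-tuple nat) :
  1 < l -> C != fset0 -> (forall i, i \in C -> is_ap (Q i)) ->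
  is_ap (ap_sum C Q) /\ ap_diff (ap_sum C Q) = \sum_(i <- C) ap_diff (Q i).
Proof.
move=> l1 /fset0Pn[j jC] HQ; have l0 : 0 < l by apply: ltnW.
have ap i : i \in C -> 0 < ap_diff (Q i) /\
    forall s, tnth (Q i) s = nth 0 (Q i) 0 + s * ap_diff (Q i).
  move=> /HQ[a [d [d0 Qi]]]; rewrite (ap_diffE l1 Qi); split=> // s.
  by rewrite Qi; have := Qi (Ordinal l0); rewrite (tnth_nth 0) /= mul0n addn0 => ->.
have sumE s : tnth (ap_sum C Q) s =
    \sum_(i <- C) nth 0 (Q i) 0 + s * \sum_(i <- C) ap_diff (Q i).
  rewrite ap_sumE big_distrr -big_split /=.
  by apply: eq_big_seq => i /ap[_ ->].
split; last exact: ap_diffE sumE.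
exists (\sum_(i <- C) nth 0 (Q i) 0), (\sum_(i <- C) ap_diff (Q i)); split=> //.
by rewrite (big_fsetD1 j) //= addn_gt0 (ap j jC).1.
Qed.

(* Main.v *)
Require Import Defs.
From mathcomp Require Import all_boot.
From mathcomp Require Import finmap.
From mathcomp Require Import zify boolp classical_sets filter.

(** Call an ultrafilter on the naturals Brauer if each of its members contains
    some d > 0 and a progression a, a + d, ..., a + (l-1)d with a > 0. By
    Brauer's theorem (van der Waerden with the difference in the same colour)
    Brauer ultrafilters exist, and they visibly form a closed subsemigroup of
    the Stone-Cech compactification. Ellis' lemma then yields an idempotent
    Brauer ultrafilter p. Starting from the colour class in p, the
    Galvin-Glazer argument picks the progressions one after the other, keeping
    all finite sums of terms, and of differences, in that class. *)

(** * The theorems of van der Waerden and Brauer *)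

(** Induction on [l] for all finite [C] at once, because colourings of whole windows serve as
    colours in the step. *)
Lemma van_der_waerden (l : nat) (C : finType) :
  exists W, forall f : nat -> C, exists a d,
    [/\ 0 < d <= W, a + l * d <= W & forall s, s <= l -> f (a + s * d) = f a].
Proof.
elim: l C => [|l IH] C.
  by exists 1 => f; exists 0, 1; split=> // s; case: s.
(* Colour focusing: progressions of distinct colours whose next term is [e]. *)
pose focused (f : nat -> C) e (ad : nat * nat) :=
  [/\ 0 < ad.2, ad.1 + l.+1 * ad.2 = e
    & forall s, s <= l -> f (ad.1 + s * ad.2) = f ad.1].
suff focusing r : exists N, forall f : nat -> C,
    (exists a d, [/\ 0 < d, a + l.+1 * d <= N
       & forall s, s <= l.+1 -> f (a + s * d) = f a]) \/
    exists e t, [/\ e <= N, size t = r, uniq [seq f x.1 | x <- t]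
       & forall x, x \in t -> focused f e x].
  have [N HN] := focusing #|C|.+1; exists N => f.
  case: (HN f) => [[a [d [d0 aN Hf]]]|[e [t [_ st ut _]]]].
    by exists a, d; split=> //; nia.
  have := max_card (mem [seq f x.1 | x <- t]).
  by rewrite (card_uniqP ut) size_map st ltnn.
elim: r => [|r [N HN]]; first by exists 0 => f; right; exists 0, [::].
(* Colour x by the colouring of the window [x, x + N]. *)
have [W HW] := IH {ffun 'I_N.+1 -> C}.
(* [W] will bound both [b + l * D] and [D], so the new focus [b + e + l.+1 * D] is at most
   [N + 2 * W]. *)
exists (N + 2 * W) => f.
have [b [D [/andP[D0 DW] bW Hg]]] := HW (fun x => [ffun j : 'I_N.+1 => f (x + j)]).
have {}Hg s j : s <= l -> j <= N -> f (b + s * D + j) = f (b + j).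
  move=> sl jN; have /ffunP/(_ (inord j)) := Hg s sl.
  by rewrite !ffunE inordK.
case: (HN (fun x => f (b + x))) => [[a [d [d0 aN Hf]]]|[e [t [eN st ut Ht]]]].
  left; exists (b + a), d; split=> //; first by lia.
  by move=> s sl; rewrite -addnA Hf.
(* Either [b + e] prolongs a focused progression of its colour, or it starts a new one of difference
   [D]; adding [D] to the old differences gives all of them the same focus. *)
case: (boolP (f (b + e) \in [seq f (b + x.1) | x <- t])) => [/mapP[[a d] xt /= fe]|fe].
  have [/= d0 ae Hf] := Ht _ xt.
  left; exists (b + a), d; split=> //; first by lia.
  move=> s; rewrite leq_eqVlt => /predU1P[->|sl]; last by rewrite -addnA Hf.
  by rewrite -addnA ae.
right; exists (b + e + l.+1 * D), ((b + e, D) :: [seq (b + x.1, x.2 + D) | x <- t]).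
split.
- by nia.
- by rewrite /= size_map st.
- by rewrite /= -map_comp fe.
move=> x; rewrite in_cons => /predU1P[->|/mapP[[a d] xt ->]].
  split=> //= s sl; by rewrite addnAC Hg.
have [/= d0 ae Hf] := Ht _ xt; split=> /=; [by lia|by lia|move=> s sl].
have -> : b + a + s * (d + D) = b + s * D + (a + s * d) by lia.
by rewrite Hg ?Hf //; nia.
Qed.

Definition has_brauer (l : nat) (A : nat -> Prop) : Prop :=
  exists a d, [/\ 0 < a, 0 < d, A d & forall s, s < l -> A (a + s * d)].

(** A colour is dropped by passing to multiples of some [d]. This is controlled only up to a bound,
    hence the finite form with [N] uniform in [f]. *)
Lemma brauer (l : nat) (C : finType) (f : nat -> C) :
  exists g, has_brauer l (fun x => f x = g).
Proof.
suff brauer_finite k : exists N, forall (f : nat -> C) (S : {set C}),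
    #|S| <= k -> (forall x, 0 < x <= N -> f x \in S) ->
    exists g, has_brauer l (fun x => f x = g).
  have [N HN] := brauer_finite #|C|; apply: (HN f [set: C]) => //.
  by rewrite cardsT.
elim: k {f} => [|k [N HN]].
  exists 1 => f S; rewrite leqn0 cards_eq0 => /eqP-> /(_ 1 isT).
  by rewrite inE.
(* Take a long progression of colour g and difference d. Either some small
   multiple of d has colour g too, or the multiples of d avoid g. *)
have [W HW] := van_der_waerden (l.+1 * N.+1) C.
exists W.+1 => f S Sk fS.
(* The shift by one keeps the terms positive; the length leaves room for all indices [j * s] with
   [j <= N] and [s < l]. *)
have [a [d [/andP[d0 dW] aW Hf]]] := HW (fun x => f x.+1).
have fa : f a.+1 \in S by apply: fS; lia.
case: (pselect (exists2 j, 0 < j <= N & f (j * d) = f a.+1)) => [[j jN fj]|nj].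
  exists (f a.+1), a.+1, (j * d); split=> //; first by nia.
  move=> s sl; rewrite mulnA addSn Hf //; nia.
have Sk' : #|S :\ f a.+1| <= k.
  by move: Sk; rewrite (cardsD1 (f a.+1) S) fa add1n ltnS.
have [x xN|g [a' [d' [a0 d'0 gd ga]]]] := HN (fun x => f (d * x)) _ Sk'.
  rewrite !inE fS ?andbT; last by nia.
  by apply/eqP => E; apply: nj; exists x; rewrite // mulnC.
exists g, (d * a'), (d * d'); split=> //; [by nia|by nia|].
by move=> s sl; rewrite -(ga s sl); congr f; lia.
Qed.

Local Open Scope classical_set_scope.

(** * Ultrafilters *)

Lemma ultra_setC {T : Type} (p : set_system T) (A : set T) :
  UltraFilter p -> p (~` A) <-> ~ p A.
Proof.
move=> pU; split=> [pAC pA|npA].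
  by have := filter_not_empty p; rewrite -(setICr A); apply; exact: filterI.
by have [] := in_ultra_setVsetC A pU.
Qed.

Lemma ultraP {T : Type} (p : set_system T) :
  ProperFilter p -> (forall A, p A \/ p (~` A)) -> UltraFilter p.
Proof.
move=> pP pVC; split=> // G GP pG; apply/seteqP; split=> // A GA.
have [//|/pG GAC] := pVC A; exfalso.
by have := filter_not_empty G; rewrite -(setICr A); apply; exact: filterI.
Qed.

Lemma not_in_filter {T : Type} (F : set_system T) (A : set T) :
  Filter F -> ~ F A -> exists q, [/\ UltraFilter q, F `<=` q & ~ q A].
Proof.
move=> FF nFA.
have GP : ProperFilter (filter_from F (fun B => B `&` ~` A)).
  apply: filter_from_proper => [|B FB].
    apply: filter_from_filter => [|B B' FB FB']; first by exists setT; exact: filterT.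
    by exists (B `&` B'); [exact: filterI|move=> x [[? ?] ?]].
  apply: contrapT => nBA; apply: nFA; apply: filterS FB => x Bx.
  by apply: contrapT => nAx; apply: nBA; exists x.
have [q [qU Gq]] := ultraFilterLemma GP.
exists q; split=> // [B FB|].
  by apply: Gq; exists B => // x [].
by apply/ultra_setC; apply: Gq; exists setT => [|x []//]; exact: filterT.
Qed.

Lemma ultra_finite_partition {T : Type} {C : finType} (f : T -> C)
    (p : set_system T) :
  UltraFilter p -> exists g, p [set x | f x = g].
Proof.
move=> pU; apply: contrapT => /forallNP np.
have : \forall x \near p, forall g, f x <> g.
  by apply: filter_forall => g; apply/ultra_setC; exact: np.
by case/filter_ex => x /(_ (f x)).
Qed.

(** * Products of filters *)

(** On ultrafilters this extends [op] to the Stone-Cech compactification of discrete [T]. For a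
    filter [p] it encodes the translate by [q] of a closed set. *)
Definition filter_mul {T : Type} (op : T -> T -> T) (p q : set_system T) :
    set_system T :=
  [set A | p [set x | q [set y | A (op x y)]]].

Lemma filter_mul_filter {T : Type} (op : T -> T -> T) (p q : set_system T) :
  Filter p -> Filter q -> Filter (filter_mul op p q).
Proof.
move=> pF qF; split=> [|A B|A B AB]; rewrite /filter_mul /=.
- by apply: filterS filterT => x _; exact: filterT.
- by apply: filterS2 => x; exact: filterI.
- by apply: filterS => x /=; apply: filterS => y; exact: AB.
Qed.

Lemma filter_mul_proper {T : Type} (op : T -> T -> T) (p q : set_system T) :
  ProperFilter p -> ProperFilter q -> ProperFilter (filter_mul op p q).
Proof.
move=> pF qF; apply: Build_ProperFilter_ex; last exact: filter_mul_filter.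
rewrite /filter_mul => A /= /filter_ex[x /filter_ex[y Axy]].
by exists (op x y).
Qed.

Lemma filter_mul_ultra {T : Type} (op : T -> T -> T) (p q : set_system T) :
  UltraFilter p -> UltraFilter q -> UltraFilter (filter_mul op p q).
Proof.
move=> pU qU; apply: ultraP; first exact: filter_mul_proper.
move=> A; have [pA|pA] := in_ultra_setVsetC [set x | q [set y | A (op x y)]] pU.
  by left.
by right; rewrite /filter_mul /=; apply: filterS pA => x /= nqA; exact/ultra_setC.
Qed.

Lemma filter_mulA {T : Type} (op : T -> T -> T) (p q r : set_system T) :
  associative op ->
  filter_mul op (filter_mul op p q) r = filter_mul op p (filter_mul op q r).
Proof.
move=> opA; apply/funext => A; rewrite /filter_mul /=; congr p.
apply/funext => x /=; congr q; apply/funext => y /=; congr r.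
by apply/funext => z /=; rewrite opA.
Qed.

(** * Ellis' lemma in terms of filters *)

(* A filter encodes the closed set of the ultrafilters above it; this says that
   this set is a subsemigroup. *)
Definition semigroup_filter {T : Type} (op : T -> T -> T) (F : set_system T) :
    Prop :=
  forall p q, UltraFilter p -> UltraFilter q -> F `<=` p -> F `<=` q ->
    F `<=` filter_mul op p q.

(** Larger filters encode smaller closed sets, so Zorn's lemma yields a minimal closed
    subsemigroup. *)
Lemma maximal_semigroup_filter {T : Type} (op : T -> T -> T)
    (F0 : set_system T) :
  ProperFilter F0 -> semigroup_filter op F0 ->
  exists F, [/\ ProperFilter F, semigroup_filter op F, F0 `<=` F
    & forall G, ProperFilter G -> semigroup_filter op G -> F `<=` G -> G `<=` F].
Proof.
move=> F0P F0S.
(* Joining [F0] makes the empty chain admissible too. *)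
pose P (F : set_system T) := ProperFilter (F0 `|` F) /\ semigroup_filter op (F0 `|` F).
have [X XP Xtot|F [[FP FS] Fmax]] := @Zorn_bigcup _ P.
  have [[F1 XF1]|X0] := pselect (X !=set0); last first.
    rewrite (_ : X = set0) ?bigcup_set0 /P ?setU0 //.
    by apply/seteqP; split=> // F XF; apply: X0; exists F.
  have inX A : (F0 `|` \bigcup_(F in X) F) A -> exists2 F, X F & (F0 `|` F) A.
    by move=> [F0A|[F XF FA]]; [exists F1; [|left]|exists F; [|right]].
  have Xin F A : X F -> (F0 `|` F) A -> (F0 `|` \bigcup_(F in X) F) A.
    by move=> XF [F0A|FA]; [left|right; exists F].
  split.
    split; first by move=> /inX[F /XP[FP _]]; exact: filter_not_empty.
    split; first by left; exact: filterT.
      move=> A B /inX[F XF FA] /inX[G XG GB].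
      have [FG|GF] := Xtot _ _ XF XG.
        have [GP _] := XP _ XG; apply: (Xin G) => //; apply: filterI => //.
        by case: FA => [|/FG]; [left|right].
      have [FP _] := XP _ XF; apply: (Xin F) => //; apply: filterI => //.
      by case: GB => [|/GF]; [left|right].
    move=> A B AB /inX[F XF FA]; apply: (Xin F) => //.
    by have [FP _] := XP _ XF; exact: filterS FA.
  move=> p q pU qU Xp Xq A /inX[F XF FA].
  have [_ FS] := XP _ XF; apply: (FS p q pU qU) FA => B /(Xin _ _ XF); [exact: Xp|exact: Xq].
exists (F0 `|` F); split=> // G GP GS FG; apply: contrapT => nGF.
have F0G : F0 `|` G = G by apply/setUidPr => A F0A; apply: FG; left.
have FltG : F `<` G.
  split=> [A FA|GF]; first by apply: FG; right.
  by apply: nGF => A /GF; right.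
by apply: (Fmax G FltG); rewrite /P F0G.
Qed.

(* Encodes the closed set of the ultrafilters q above F with q p = r. *)
Definition filter_quotient {T : Type} (op : T -> T -> T) (F p r : set_system T) :
    set_system T :=
  filter_from [set BA | F BA.1 /\ r BA.2]
    (fun BA => BA.1 `&` [set x | p [set y | BA.2 (op x y)]]).

(** If the generator given by [B] and [A] were empty, the complement of [A] would lie in
    [filter_mul op F p], hence in [r] together with [A]. *)
Lemma filter_quotient_proper {T : Type} (op : T -> T -> T)
    (F p r : set_system T) :
  Filter F -> UltraFilter p -> ProperFilter r -> filter_mul op F p `<=` r ->
  ProperFilter (filter_quotient op F p r).
Proof.
move=> FF pU rP Fpr; apply: filter_from_proper => [|[B A] /= [FB rA]].
  apply: filter_from_filter.
    by exists (setT, setT); split; exact: filterT.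
  move=> [B A] [B' A'] /= [FB rA] [FB' rA'].
  exists (B `&` B', A `&` A') => [|x /= [[Bx B'x] pAA']].
    by split; exact: filterI.
  by split; split=> //; apply: filterS pAA' => y [].
apply: contrapT => nBA.
have : r (~` A).
  apply: Fpr; apply: filterS FB => x Bx; apply/ultra_setC => pA.
  by apply: nBA; exists x.
by move=> /(filterI rA); rewrite setICr; exact: filter_not_empty.
Qed.

Lemma le_filter_quotient {T : Type} (op : T -> T -> T) (F p r : set_system T) :
  Filter r -> F `<=` filter_quotient op F p r.
Proof. by move=> rF B FB; exists (B, setT) => [|x []//]; split=> //; exact: filterT. Qed.

Lemma filter_quotient_le {T : Type} (op : T -> T -> T)
    (F p r q : set_system T) :
  Filter F -> Filter q -> filter_quotient op F p r `<=` q ->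
  r `<=` filter_mul op q p.
Proof.
move=> FF qF Hq A rA; apply: Hq; exists (setT, A) => [|x []//].
by split=> //; exact: filterT.
Qed.

Lemma idempotent_ultrafilter {T : Type} (op : T -> T -> T)
    (F0 : set_system T) :
  associative op -> ProperFilter F0 -> semigroup_filter op F0 ->
  exists p, [/\ UltraFilter p, F0 `<=` p & p `<=` filter_mul op p p].
Proof.
move=> opA F0P F0S.
have [F [FP FS F0F Fmax]] := maximal_semigroup_filter _ _ F0P F0S.
have [p [pU Fp]] := ultraFilterLemma FP.
exists p; split=> //; first exact: subset_trans Fp.
(* As in Ellis' lemma: by minimality of the semigroup S encoded by [F], first
   S p = S, then {q in S | q p = p} = S, which contains p. *)
have Fpp : filter_mul op F p `<=` F.
  apply: Fmax.
  - exact: filter_mul_proper.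
  (* S p consists of products q p, and (q p q') p is again one because S is a semigroup. *)
  - have factor r : UltraFilter r -> filter_mul op F p `<=` r ->
        exists q, [/\ UltraFilter q, F `<=` q & r = filter_mul op q p].
      move=> rU Fpr; have HP : ProperFilter (filter_quotient op F p r).
        exact: filter_quotient_proper.
      have [q [qU Hq]] := ultraFilterLemma HP; exists q; split=> //.
        by apply: subset_trans Hq; exact: le_filter_quotient.
      have rqp : r `<=` filter_mul op q p by exact: filter_quotient_le Hq.
      by apply/esym; apply: max_filter rqp; exact: filter_mul_proper.
    move=> r r' rU r'U /(factor _ rU)[q [qU Fq ->]] /(factor _ r'U)[q' [q'U Fq' ->]].
    rewrite -!(filter_mulA op _ _ _ opA) => A.
    apply: (FS (filter_mul op q p) q') => //; first exact: filter_mul_ultra.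
    exact: FS.
  - move=> A FA; apply: contrapT => nFpA.
    have [q [qU Fq]] := not_in_filter F [set x | p [set y | A (op x y)]] _ nFpA.
    by apply; exact: FS FA.
have HP : ProperFilter (filter_quotient op F p p).
  by apply: filter_quotient_proper; exact: subset_trans Fp.
have HS : semigroup_filter op (filter_quotient op F p p).
  move=> q q' qU q'U Hq Hq' A [[B A'] /= [FB pA']] BA.
  have qp : p `<=` filter_mul op q p by exact: filter_quotient_le Hq.
  have q'p : p `<=` filter_mul op q' p by exact: filter_quotient_le Hq'.
  have qq'U := filter_mul_ultra op q q' qU q'U.
  apply: (@filterS _ (filter_mul op q q') _ _ _ BA).
  apply: (@filterI _ (filter_mul op q q')).
    by apply: FS FB => //; [apply: subset_trans Hq|apply: subset_trans Hq'];
      exact: le_filter_quotient.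
  (* This is the computation q q' p = q p = p. *)
  suff : filter_mul op (filter_mul op q q') p A' by [].
  rewrite filter_mulA //; apply: (@filterS _ q) (qp _ pA') => x; exact: q'p.
have HF : filter_quotient op F p p `<=` F.
  by apply: Fmax => //; exact: le_filter_quotient.
exact: filter_quotient_le (subset_trans HF Fp).
Qed.

(** * An idempotent Brauer ultrafilter *)

Lemma has_brauer_sub (l : nat) (A B : set nat) :
  A `<=` B -> has_brauer l A -> has_brauer l B.
Proof.
by move=> AB [a [d [a0 d0 Ad Aa]]]; exists a, d; split=> // [|s /Aa]; exact: AB.
Qed.

Lemma idempotent_brauer_ultrafilter (l : nat) :
  exists p : set_system nat,
    [/\ UltraFilter p, forall A, p A -> has_brauer l A & p `<=` filter_mul addn p p].
Proof.
(* [F0] encodes the Brauer ultrafilters. *)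
pose F0 : set_system nat := [set A | exists (C : finType) (f : nat -> C),
  forall g, ~ has_brauer l (~` A `&` [set x | f x = g])].
(* Complements of members of [F0] are finite unions of sets without Brauer configurations; by
   Brauer's theorem they are never all of the naturals. *)
have F0P : ProperFilter F0.
  split=> [[C [f nf]]|].
    have [g fg] := brauer l C f; apply: (nf g); apply: has_brauer_sub fg.
    by rewrite setC0 setTI.
  split.
  - exists unit, (fun=> tt) => g [a [d [_ _ []]]].
    by rewrite setCT.
  - move=> A B [C [f nf]] [C' [f' nf']].
    exists (bool * C * C')%type, (fun x => (`[< A x >], f x, f' x)) => -[[b c] c'].
    case: b => H; [apply: (nf' c')|apply: (nf c)]; apply: has_brauer_sub H => x /=.
      by move=> [nAB [/asboolP Ax _ fx]]; split=> // Bx; apply: nAB.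
    by move=> [_ [/asboolP Ax fx _]].
  - move=> A B AB [C [f nf]]; exists C, f => g H; apply: (nf g).
    by apply: has_brauer_sub H; apply: setSI; exact: subsetC.
have F0E p : UltraFilter p -> F0 `<=` p <-> forall A, p A -> has_brauer l A.
  move=> pU; split=> [Fp A pA|Hp A [C [f nf]]].
    apply: contrapT => nA; have : p (~` A).
      apply: Fp; exists unit, (fun=> tt) => g H; apply: nA.
      by apply: has_brauer_sub H => x [/contrapT].
    by apply/(ultra_setC p (~` A)); rewrite setCK.
  apply: contrapT => /(ultra_setC p A) pAC.
  have [g pg] := ultra_finite_partition f p pU.
  by apply: (nf g); apply: Hp; exact: filterI.
(* A configuration found through [p] and one found through [q] in finitely many translates of [A]
   add up termwise. *)
have F0S : semigroup_filter addn F0.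
  move=> p q pU qU /(F0E p pU) Hp /(F0E q qU) Hq.
  have pqU := filter_mul_ultra addn p q pU qU.
  apply/(F0E _ pqU) => A /Hp[a [d [a0 d0 qd qa]]].
  have : q [set y | A (d + y) /\ forall s : 'I_l, A (a + s * d + y)].
    apply: filterI => //; apply: filter_forall => s; exact: qa.
  move=> /Hq[a' [d' [a'0 d'0 [Ad' _] Aa']]].
  exists (a + a'), (d + d'); split=> [||//|s sl]; [by lia|by lia|].
  have [_ /(_ (Ordinal sl)) /=] := Aa' s sl.
  by congr A; lia.
have [p [pU Fp pp]] := idempotent_ultrafilter addn F0 addnA F0P F0S.
by exists p; split=> //; exact/F0E.
Qed.

(** Colouring the numbers up to [M] by their values leaves single points, but a Brauer set has two
    elements as [1 < l]. *)
Lemma brauer_ultrafilter_gt (l : nat) (p : set_system nat) (M : nat) :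
  1 < l -> UltraFilter p -> (forall A, p A -> has_brauer l A) ->
  p [set x | M < x].
Proof.
move=> l1 pU Hp; apply: contrapT => /(ultra_setC p) pM.
have [g] := ultra_finite_partition (fun x => inord x : 'I_M.+1) p pU.
move=> /(filterI pM)/Hp[a [d [a0 d0 _ Ha]]].
have val s : s < l -> a + s * d = g.
  move=> sl; have [/negP] := Ha s sl; rewrite -leqNgt => aM /= <-.
  by rewrite inordK.
by have := val 0 (ltnW l1); have := val 1 l1; lia.
Qed.

(** * The Galvin-Glazer construction *)

(* Galvin's argument: [u i + B i.+1] stays in [B i]. *)
Lemma sum_in_decreasing_sets (B : nat -> set nat) (u : nat -> nat) :
  (forall i, B i.+1 `<=` B i) -> (forall i, B i (u i)) ->
  (forall i y, B i.+1 y -> B i (u i + y)) ->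
  forall C : {fset nat}, C != fset0 -> B 0 (\sum_(i <- C) u i).
Proof.
move=> Bdec Bu Bstep C C0.
have Ble i j : i <= j -> B j `<=` B i.
  elim: j => [|j IH]; first by rewrite leqn0 => /eqP->.
  rewrite leq_eqVlt => /predU1P[->//|/IH]; exact: subset_trans.
have path_sum t i : path ltn i t -> B i (u i + \sum_(j <- t) u j).
  elim: t i => [|j t IH] i /=; first by rewrite big_nil addn0.
  by move=> /andP[ij /IH]; rewrite big_cons => /(Ble _ _ ij); exact: Bstep.
(* In increasing order, each index is followed by a tail in a later set, as [path_sum] requires. *)
have perm := permEl (perm_sort leq (enum_fset C)).
have srt : sorted ltn (sort leq (enum_fset C)).
  by rewrite ltn_sorted_uniq_leq sort_uniq fset_uniq (sort_sorted leq_total).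
rewrite -(perm_big _ perm) /=.
case: (sort _ _) srt (perm_size perm) => [_ /esym E|i t /= it _].
  by case/negP: C0; rewrite -cardfs_eq0; apply/eqP; exact: E.
by rewrite big_cons; apply: (Ble 0 i) => //; exact: path_sum.
Qed.

Lemma monochromatic_sums (l : nat) (p : set_system nat) (A : set nat) :
  1 < l -> UltraFilter p -> (forall A, p A -> has_brauer l A) ->
  p `<=` filter_mul addn p p -> p A ->
  exists a d : nat -> nat,
    [/\ forall i, 0 < a i /\ 0 < d i, forall i, a i + l * d i < a i.+1
      & forall C : {fset nat}, C != fset0 -> A (\sum_(i <- C) d i) /\
          forall s, s < l -> A (\sum_(i <- C) (a i + s * d i))].
Proof.
move=> l1 pU Hp pp pA.
(* A state is the current set with a bound that the next progression must exceed. The premise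
   [p BM.1] lets [step] be total. *)
pose good (BM : set nat * nat) (ad : nat * nat) := p BM.1 ->
  [/\ BM.2 < ad.1, 0 < ad.2,
    BM.1 ad.2 /\ p [set y | BM.1 (ad.2 + y)]
  & forall s, s < l -> BM.1 (ad.1 + s * ad.2) /\ p [set y | BM.1 (ad.1 + s * ad.2 + y)]].
have [step Hstep] : {step & forall BM, good BM (step BM)}.
  apply: choice => -[B M]; have [pB|npB] := pselect (p B); last first.
    by exists (0, 0) => /npB.
  have pM := brauer_ultrafilter_gt l p M l1 pU Hp.
  have [a [d [a0 d0 [[Bd pd] _] Ha]]] := Hp _ (filterI (filterI pB (pp _ pB)) pM).
  exists (a, d) => _; split=> //=.
    by have [_] := Ha 0 (ltnW l1); rewrite mul0n addn0.
  by move=> s /Ha[[]].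
(* Translates by the difference and by all [l] terms are kept at once, so one sequence [B] serves
   every kind of sum. *)
pose next (BM : set nat * nat) :=
  let ad := step BM in
  ([set y | [/\ BM.1 y, BM.1 (ad.2 + y)
      & forall s : 'I_l, BM.1 (ad.1 + s * ad.2 + y)]], ad.1 + l * ad.2).
pose st i := iter i next (A, 0).
pose B i := (st i).1; pose a i := (step (st i)).1; pose d i := (step (st i)).2.
have pB i : p (B i).
  elim: i => [//|i IH]; have [_ _ [_ pd] pa] := Hstep (st i) IH.
  have pas : p [set y | forall s : 'I_l, B i (a i + s * d i + y)].
    by apply: filter_forall => s; have [] := pa s (ltn_ord s).
  by apply: filterS (filterI IH (filterI pd pas)) => y [? []].
exists a, d; split=> [i|i|C C0].
- have [ai di _ _] := Hstep (st i) (pB i); split=> //.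
  exact: leq_ltn_trans ai.
- by have [] := Hstep (st i.+1) (pB i.+1).
have Bdec i : B i.+1 `<=` B i by move=> y [].
split=> [|s sl]; apply: (sum_in_decreasing_sets B) => // i.
- by have [_ _ []] := Hstep (st i) (pB i).
- by move=> y [].
- by have [_ _ _ /(_ s sl)[]] := Hstep (st i) (pB i).
- by move=> y [_ _ /(_ (Ordinal sl))].
Qed.

(** * Monochromatic sums of progressions *)

Theorem theorem3p2 (c l : nat) (hc : 0 < c) (hl : 3 <= l)
    (col : nat -> nat) (hcol : forall n : nat, 0 < n -> 1 <= col n <= c) :
  exists Q : nat -> l.-tuple nat,
    [/\ forall i : nat, 0 < i ->
          is_ap (Q i) /\ (forall s : 'I_l, 0 < tnth (Q i) s),
        forall i : nat, 0 < i -> ap_prec (Q i) (Q i.+1)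
      & exists gamma : nat, 1 <= gamma <= c /\
          forall C : {fset nat}, C != fset0 -> (forall i, i \in C -> 0 < i) ->
          forall s : 'I_l,
            col (tnth (ap_sum C Q) s) = gamma /\
            col (ap_diff (ap_sum C Q)) = gamma].
Proof.
have l1 : 1 < l by apply: ltnW.
have [p [pU Hp pp]] := idempotent_brauer_ultrafilter l.
have [g pg] := ultra_finite_partition (fun x => inord (col x) : 'I_c.+1) p pU.
have p0 := brauer_ultrafilter_gt l p 0 l1 pU Hp.
(* [hcol] bounds colours only at positive numbers; there [inord] loses nothing. *)
have pA : p [set x | 0 < x /\ col x = g].
  apply: filterS (filterI p0 pg) => x /= [x0 <-]; split=> //.
  by rewrite inordK // ltnS; case/andP: (hcol x x0).
have [a [d [ad0 ad AC]]] := monochromatic_sums l p _ l1 pU Hp pp pA.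
pose Q i := [tuple a i + s * d i | s < l].
have QE i s : tnth (Q i) s = a i + s * d i by rewrite tnth_mktuple.
have Qap i : is_ap (Q i) by exists (a i), (d i); have [] := ad0 i.
exists Q; split=> [i _|i _ s|].
- split=> // s; rewrite QE; have [] := ad0 i; lia.
- rewrite !QE; have := ad i; have := ltn_ord s; nia.
exists g; split=> [|C C0 _ s].
  have [x [x0 <-]] := filter_ex pA; exact: hcol.
have [Ad Aa] := AC C C0; split.
  rewrite ap_sumE (eq_bigr (fun i => a i + s * d i)) => [|i _]; last exact: QE.
  by have [] := Aa s (ltn_ord s).
have [_ ->] := is_ap_sum l1 C0 (fun i _ => Qap i).
rewrite (eq_bigr d) => [|i _]; last exact: ap_diffE (QE i).
by case: Ad.
Qed.
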